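(* Let $u\in\mathcal{F}_{\mathrm N}(\mathbb{R})\cap\mathcal{F}_{\mathrm C}(\mathbb{R})$ and $w\in\mathcal{F}_{\mathrm D}(\mathbb{R})$. Suppose that: (i) $w(w^-(0))=u(u^-(0))$ and $w(w^+(0))=u(u^+(0))$; (ii-1) if $u^-(1)$ is an inner point of $[u]_0$ at which $u$ is not differentiable, then $w'_-(w^-(1))=0$; (ii-2) if $u^+(1)$ is an inner point of $[u]_0$ at which $u$ is not differentiable, then $w'_+(w^+(1))=0$. Then $w$ is a smoother of $u$, i.e. $u\nabla w\in\mathcal{F}_{\mathrm D}(\mathbb{R})$.
   Context: A fuzzy number is a map $u:\mathbb{R}\to[0,1]$ such that, writing $[u]_\alpha=\{x:u(x)\ge\alpha\}$ for $\alpha\in(0,1]$ and $[u]_0=\overline{\{x:u(x)>0\}}$, the set $[u]_1$ is nonempty and each $[u]_\alpha=[u^-(\alpha),u^+(\alpha)]$, $\alpha\in[0,1]$, is a compact interval. $\mathcal{F}(\mathbb{R})$ is the set of all fuzzy numbers. $\mathcal{F}_{\mathrm N}(\mathbb{R})$: fuzzy numbers differentiable on $(u^-(0),u^-(1))\cup(u^+(1),u^+(0))$. $\mathcal{F}_{\mathrm C}(\mathbb{R})$: fuzzy numbers $u$ continuous on $[u]_0$ (i.e. the restriction to $[u]_0$ is continuous). $\mathcal{F}_{\mathrm D}(\mathbb{R})$: those $u\in\mathcal{F}_{\mathrm C}(\mathbb{R})$ differentiable on $(u^-(0),u^+(0))$. The sup-min convolution is $(u\nabla v)(x)=\sup_{y\in\mathbb{R}}\min\{u(y),v(x-y)\}$;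 it is a fuzzy number with $[u\nabla v]_\alpha=[u]_\alpha+[v]_\alpha$. For $u\in\mathcal{F}(\mathbb{R})$ and $v\in\mathcal{F}_{\mathrm D}(\mathbb{R})$, $v$ is a smoother of $u$ if $u\nabla v\in\mathcal{F}_{\mathrm D}(\mathbb{R})$. $f'_-,f'_+$ denote left and right derivatives. An inner point of $[u]_0$ is a point of $(u^-(0),u^+(0))$. *)

(* Defs.v *)
From HB Require Import structures.
From mathcomp Require Import all_boot all_order all_algebra.
From mathcomp Require Import all_classical all_reals all_analysis.

Set Implicit Arguments.
Unset Strict Implicit.
Unset Printing Implicit Defensive.

Import Order.TTheory GRing.Theory Num.Theory.
Import numFieldNormedType.Exports.

Local Open Scope classical_set_scope.
Local Open Scope ring_scope.

Definition level_cut (R : realType) (u : R -> R) (a : R) : set R :=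
  if a == 0 then closure [set x | 0 < u x] else [set x | a <= u x].

(* For a fuzzy number every cut with level in [0, 1] is a nonempty compact
   interval, so [inf] and [sup] are its actual endpoints u^-(a) and u^+(a). *)
Definition lend (R : realType) (u : R -> R) (a : R) : R := inf (level_cut u a).
Definition rend (R : realType) (u : R -> R) (a : R) : R := sup (level_cut u a).

(* The cuts decrease with the level, so nonemptiness of [level_cut u 1] forces
   l <= r in the intervals below. *)
Definition fuzzy_number (R : realType) (u : R -> R) : Prop :=
  [/\ (forall x, 0 <= u x <= 1),
      level_cut u 1 !=set0 &
      forall a, 0 <= a <= 1 -> exists l r : R, level_cut u a = `[l, r]%classic].

Definition fuzzyN (R : realType) (u : R -> R) : Prop :=
  fuzzy_number u /\
  forall x, (x \in `]lend u 0, lend u 1[) \/ (x \in `]rend u 1, rend u 0[) ->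
    derivable u x 1.

Definition fuzzyC (R : realType) (u : R -> R) : Prop :=
  fuzzy_number u /\ {within level_cut u 0, continuous u}.

Definition fuzzyD (R : realType) (u : R -> R) : Prop :=
  fuzzyC u /\ forall x, x \in `]lend u 0, rend u 0[ -> derivable u x 1.

(* The set of values is nonempty and, for fuzzy numbers, bounded by 1, so the
   real-valued [sup] is a genuine supremum. *)
Definition supmin (R : realType) (u v : R -> R) : R -> R :=
  fun x => sup (range (fun y => Num.min (u y) (v (x - y)))).

(* v is a smoother of u *)
Definition smoother (R : realType) (u v : R -> R) : Prop :=
  [/\ fuzzy_number u, fuzzyD v & fuzzyD (supmin u v)].

Definition is_lderive (R : realType) (f : R -> R) (x l : R) : Prop :=
  (f (x + h) - f x) / h @[h --> 0^'-] --> l.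
Definition is_rderive (R : realType) (f : R -> R) (x l : R) : Prop :=
  (f (x + h) - f x) / h @[h --> 0^'+] --> l.

(* Main.v *)
(* Let z be the sup-min convolution of u and w.  On the left branch every x splits
   as y + t with u y = w t (intermediate value theorem, using that both functions
   start from the same value), and monotonicity gives
     min (u y') (w t') <= z (y' + t') <= max (u y') (w t')
   for all y', t' left of the cores.  Moving y by l h and t by (1 - l) h, with l
   chosen so that l u'(y) = (1 - l) w'(t), squeezes z (x + h) between two functions
   with the same value and slope at h = 0.  At the left end of the core, z is
   squeezed between the constant 1 and a translate of either u or w that has left
   derivative 0.  The right branch follows by the reflection x |-> - x. *)
Require Import Defs.
From HB Require Import structures.
From mathcomp Require Import all_boot all_order all_algebra.
From mathcomp Require Import all_classical all_reals all_analysis.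
From mathcomp Require Import ring lra.

Set Implicit Arguments.
Unset Strict Implicit.

Import Order.TTheory GRing.Theory Num.Theory.
Import numFieldNormedType.Exports.

Local Open Scope classical_set_scope.
Local Open Scope ring_scope.

(** * First-order expansions at 0 and their calculus *)

(* First-order expansion [f h = c + d * h + o(h)] as [h] tends to 0 inside [A];
   choosing [A] as a half-line gives one-sided derivatives. *)
Definition expands {R : realType} (A : set R) (f : R -> R) (c d : R) : Prop :=
  forall e, 0 < e ->
    \forall h \near (0 : R), A h -> `|f h - c - d * h| <= e * `|h|.

(** Multiplying the difference-quotient estimate by [|h|] removes the division, so [h = 0] needs no
    exclusion. *)
Lemma derivable_expands {R : realType} (f : R -> R) (x : R) :
  derivable f x 1 <-> exists d, expands setT (fun h => f (x + h)) (f x) d.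
Proof.
split=> [df|[d fd]].
  exists ('D_1 f x) => e e0.
  have /cvgr_dist_le/(_ e e0) : h^-1 *: ((f \o shift x) (h *: (1 : R)) - f x)
      @[h --> 0^'] --> 'D_1 f x by exact: df.
  rewrite /dnbhs near_withinE; apply: filterS => h /= fh _.
  have [->|h0] := eqVneq h 0; first by rewrite addr0 mulr0 subrr subr0 !normr0 mulr0.
  have {fh} := fh h0; rewrite /GRing.scale /= mulr1 (addrC h x).
  have -> : f (x + h) - f x - 'D_1 f x * h
      = (h^-1 * (f (x + h) - f x) - 'D_1 f x) * h by field.
  by rewrite normrM distrC => fh; rewrite ler_wpM2r.
apply/cvg_ex; exists d; apply/cvgrPdist_le => e e0.
have := fd e e0; rewrite /dnbhs near_withinE; apply: filterS => h /= fh h0.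
rewrite /GRing.scale /= mulr1 (addrC h x) distrC.
have -> : h^-1 * (f (x + h) - f x) - d = (f (x + h) - f x - d * h) / h by field.
by rewrite normrM normfV ler_pdivrMr ?normr_gt0//; exact: fh.
Qed.

Lemma is_lderive_expands {R : realType} (f : R -> R) (x d : R) :
  is_lderive f x d -> expands [set h | h < 0] (fun h => f (x + h)) (f x) d.
Proof.
move=> /cvgr_dist_le fd e e0; have := fd e e0.
rewrite /at_left near_withinE; apply: filterS => h /= fh h0.
have {}fh := fh h0.
have hn0 : h != 0 by rewrite lt_eqF.
have -> : f (x + h) - f x - d * h = ((f (x + h) - f x) / h - d) * h by field.
by rewrite normrM distrC ler_wpM2r.
Qed.

Lemma is_rderive_expands {R : realType} (f : R -> R) (x d : R) :
  is_rderive f x d -> expands [set h | 0 < h] (fun h => f (x + h)) (f x) d.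
Proof.
move=> /cvgr_dist_le fd e e0; have := fd e e0.
rewrite /at_right near_withinE; apply: filterS => h /= fh h0.
have {}fh := fh h0.
have hn0 : h != 0 by rewrite gt_eqF.
have -> : f (x + h) - f x - d * h = ((f (x + h) - f x) / h - d) * h by field.
by rewrite normrM distrC ler_wpM2r.
Qed.

Lemma expands_cst {R : realType} (A : set R) (f : R -> R) (c : R) :
  (\forall h \near (0 : R), A h -> f h = c) -> expands A f c 0.
Proof.
move=> fc e e0; apply: filterS fc => h fh /fh ->.
by rewrite subrr mul0r subr0 normr0 mulr_ge0// ltW.
Qed.

Lemma expands_sub {R : realType} (A B : set R) (f : R -> R) (c d : R) :
  A `<=` B -> expands B f c d -> expands A f c d.
Proof. by move=> AB fd e e0; apply: filterS (fd e e0) => h fh /AB/fh. Qed.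

(** The two half-lines omit [h = 0]; there the estimate holds because the constant term is [f 0]
    itself. *)
Lemma expandsT {R : realType} (f : R -> R) (d : R) :
  expands [set h | h < 0] f (f 0) d -> expands [set h | 0 < h] f (f 0) d ->
  expands setT f (f 0) d.
Proof.
move=> fl fr e e0; near=> h => _.
have [h0|h0|->] := ltgtP h 0.
- have : [set h | h < 0] h -> `|f h - f 0 - d * h| <= e * `|h|
    by near: h; exact: fl.
  by apply.
- have : [set h | 0 < h] h -> `|f h - f 0 - d * h| <= e * `|h|
    by near: h; exact: fr.
  by apply.
- by rewrite mulr0 subrr subr0 !normr0 mulr0.
Unshelve. all: by end_near. Qed.

Lemma near0N {R : realType} (P : R -> Prop) :
  (\forall h \near (0 : R), P h) -> \forall h \near (0 : R), P (- h).
Proof.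
move=> P0; have h0 : - h @[h --> (0 : R)] --> (0 : R).
  by rewrite -[X in _ --> X]oppr0; apply: cvgN; exact: cvg_id.
exact: h0 P0.
Qed.

Lemma expandsN {R : realType} (A : set R) (f : R -> R) (c d : R) :
  expands A f c d -> expands (-%R @^-1` A) (f \o -%R) c (- d).
Proof.
move=> fd e e0.
have := near0N (fd e e0); apply: filterS => h /= fh Ah.
by have := fh Ah; rewrite mulrN mulNr normrN.
Qed.

Lemma expands_scale {R : realType} (f : R -> R) (x c p l : R) :
  expands setT (fun h => f (x + h)) c p ->
  expands setT (fun h => f (x + l * h)) c (l * p).
Proof.
(* Adding 1 keeps the divisor positive when [l = 0]. *)
move=> fp e e0; have l0 : 0 < `|l| + 1 by rewrite ltr_wpDl.
have lh0 : l * h @[h --> (0 : R)] --> (0 : R).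
  by rewrite -[X in _ --> X](mulr0 l); apply: cvgMl_tmp; exact: cvg_id.
have near_fp : \forall h \near (0 : R),
    setT (l * h) -> `|f (x + l * h) - c - p * (l * h)| <= e / (`|l| + 1) * `|l * h|.
  exact: lh0 (fp _ (divr_gt0 e0 l0)).
apply: filterS near_fp => h fh _.
have := fh I; rewrite mulrA (mulrC p l) => /le_trans; apply.
rewrite normrM mulrA ler_wpM2r// -mulrA ger_pMr// ler_pdivrMl//.
by rewrite mulr1 lerDl.
Qed.

(** The [min] and [max] leave open which of [f] and [g] is larger. Both lie within [e * |h|] of
    [c + d * h], hence so does anything between them. *)
Lemma expands_squeeze {R : realType} (A : set R) (f g k : R -> R) (c d : R) :
  (\forall h \near (0 : R), A h ->
     Num.min (f h) (g h) <= k h <= Num.max (f h) (g h)) ->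
  expands A f c d -> expands A g c d -> expands A k c d.
Proof.
move=> fgk fd gd e e0; near=> h => Ah.
have : A h -> `|f h - c - d * h| <= e * `|h| by near: h; exact: fd.
have : A h -> `|g h - c - d * h| <= e * `|h| by near: h; exact: gd.
have : A h -> Num.min (f h) (g h) <= k h <= Num.max (f h) (g h) by near: h.
move=> /(_ Ah) + /(_ Ah) + /(_ Ah); rewrite !ler_norml ge_min le_max.
by move=> /andP[/orP[|] ? /orP[|] ?] /andP[? ?] /andP[? ?]; lra.
Unshelve. all: by end_near. Qed.

Lemma expands_ge0 {R : realType} (f : R -> R) (c d : R) :
  expands [set h | h < 0] f c d ->
  (\forall h \near (0 : R), h < 0 -> f h <= c) -> 0 <= d.
Proof.
move=> fd fc; rewrite leNgt; apply/negP => d0.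
(* With this tolerance the expansion and [f h <= c] give [d * h <= d * h / 2] for small [h < 0],
   although [d * h > 0]. *)
have e0 : 0 < - d / 2 by lra.
have : \forall h \near (0 : R)^'-, d * h <= - d / 2 * (- h).
  rewrite /at_left near_withinE; near=> h => h0.
  have : h < 0 -> f h <= c by near: h.
  have : [set h | h < 0] h -> `|f h - c - d * h| <= - d / 2 * `|h|
    by near: h; exact: fd.
  move=> /(_ h0) + /(_ h0); rewrite (ltr0_norm h0) ler_norml => /andP[? ?] ?; lra.
move=> H; have [h [h0 dh]] : exists h : R, h < 0 /\ d * h <= - d / 2 * (- h).
  have K : \forall h \near (0 : R)^'-, h < 0 by rewrite /at_left near_withinE; near=> h.
  by have [h [? ?]] := filter_ex (filterI K H); exists h.
by nra.
Unshelve. all: by end_near. Qed.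

(** * Small increments and continuity on a set *)

Lemma near0_lt_add {R : realType} (x y l : R) :
  x < y -> \forall h \near (0 : R), x + l * h < y.
Proof.
move=> xy; have h0 : x + l * h @[h --> (0 : R)] --> x.
  rewrite -[X in _ --> X]addr0 -[X in _ --> _ + X](mulr0 l).
  by apply: cvgD; [exact: cvg_cst|apply: cvgMl_tmp; exact: cvg_id].
exact: (cvgr_lt x h0).
Qed.

Lemma near0_gt_add {R : realType} (x y l : R) :
  y < x -> \forall h \near (0 : R), y < x + l * h.
Proof.
move=> xy; have : - x < - y by rewrite ltrN2.
by move=> /(near0_lt_add (- l)); apply: filterS => h; rewrite mulNr; lra.
Qed.

(** Continuity in terms of increments [h] near 0, the form in which estimates for [u] at [y + h] and
    [w] at [x - y - h] combine. *)
Lemma within_continuousP {R : realType} (A : set R) (f : R -> R) :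
  {within A, continuous f} <->
  forall x e : R, A x -> 0 < e ->
    \forall h \near (0 : R), A (x + h) -> `|f (x + h) - f x| <= e.
Proof.
split=> [/subspace_continuousP fc x e Ax e0|fc].
  have /cvgrPdist_le/(_ e e0) := fc x Ax.
  rewrite near_withinE => /nbhs0P; apply: filterS => h /= fh /fh.
  by rewrite distrC.
apply/subspace_continuousP => x Ax; apply/cvgrPdist_le => e e0.
rewrite near_withinE.
apply/(nbhs0P (fun y => A y -> `|f x - f y| <= e)).
by apply: filterS (fc x e Ax e0) => h fh /fh; rewrite distrC.
Qed.

(** * Unimodal shape of continuous fuzzy numbers *)

(* For a fuzzy number continuous on its support: [a, d] is the 0-level cut and
   [b, c] the 1-level cut. *)
Record unimodal {R : realType} (f : R -> R) (a b c d : R) : Prop := Unimodal {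
  um_ab : a <= b;
  um_bc : b <= c;
  um_cd : c <= d;
  um_ge0 : forall x, 0 <= f x;
  um_le1 : forall x, f x <= 1;
  um_top : forall x, b <= x -> x <= c -> f x = 1;
  um_ltl : forall x, x < b -> f x < 1;
  um_ltr : forall x, c < x -> f x < 1;
  um_nd : forall x y, x <= y -> y <= b -> f x <= f y;
  um_ni : forall x y, c <= x -> x <= y -> f y <= f x;
  um_outl : forall x, x < a -> f x = 0;
  um_outr : forall x, d < x -> f x = 0;
  um_cont : {within `[a, d], continuous f} }.

Lemma unimodalN {R : realType} (f : R -> R) (a b c d : R) :
  unimodal f a b c d -> unimodal (f \o -%R) (- d) (- c) (- b) (- a).
Proof.
case=> ab bc cd f0 f1 ft fl fr fnd fni fol fou /within_continuousP fc.
split; rewrite ?lerN2//=.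
- by move=> x ? ?; apply: ft; lra.
- by move=> x ?; apply: fr; lra.
- by move=> x ?; apply: fl; lra.
- by move=> x y ? ?; apply: fni; lra.
- by move=> x y ? ?; apply: fnd; lra.
- by move=> x ?; apply: fou; lra.
- by move=> x ?; apply: fol; lra.
- apply/within_continuousP => x e /= xad e0.
  have xad' : `[a, d]%classic (- x) by move: xad; rewrite /= !in_itv /=; lra.
  have := near0N (fc _ _ xad' e0); apply: filterS => h /= fh xhad.
  by rewrite opprD; apply: fh; move: xhad; rewrite /= !in_itv /=; lra.
Qed.

Lemma level_cut_gt0 {R : realType} (f : R -> R) (r : R) :
  0 < r -> level_cut f r = [set x | r <= f x].
Proof. by move=> r0; rewrite /level_cut gt_eqF. Qed.

Lemma level_cut0 {R : realType} (f : R -> R) :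
  level_cut f 0 = closure [set x | 0 < f x].
Proof. by rewrite /level_cut eqxx. Qed.

(** Convexity of the level cuts makes [f] quasi-concave; comparison with a core endpoint turns this
    into monotonicity on either side of the core. *)
Lemma fuzzyC_unimodal {R : realType} (f : R -> R) : fuzzyC f ->
  level_cut f 0 = `[lend f 0, rend f 0]%classic /\
  unimodal f (lend f 0) (lend f 1) (rend f 1) (rend f 0).
Proof.
move=> [[f01 [m fm] fcut] fc].
have fm1 : 1 <= f m by move: fm; rewrite level_cut_gt0.
have cut0 : level_cut f 0 m.
  by rewrite level_cut0; apply: subset_closure => /=; lra.
have cutE r : 0 <= r <= 1 -> level_cut f r m ->
    [/\ level_cut f r = `[lend f r, rend f r]%classic,
        lend f r <= m & m <= rend f r].
  move=> r01 mr; have [x [y E]] := fcut r r01; move: mr; rewrite E /= in_itv /=.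
  move=> /andP[xm my]; have xy := le_trans xm my.
  by rewrite /lend /rend E inf_itvcc// sup_itvcc.
have [E1 am md] : [/\ level_cut f 0 = `[lend f 0, rend f 0]%classic,
   lend f 0 <= m & m <= rend f 0] by apply: cutE => //; lra.
have [E2 bm mc] : [/\ level_cut f 1 = `[lend f 1, rend f 1]%classic,
   lend f 1 <= m & m <= rend f 1] by apply: cutE => //; lra.
rewrite E1 in fc; split=> //.
set a := lend f 0 in E1 fc am *; set d := rend f 0 in E1 fc md *.
set b := lend f 1 in E2 bm *; set c := rend f 1 in E2 mc *.
have f0 x : 0 <= f x by have := f01 x; lra.
have f1 x : f x <= 1 by have := f01 x; lra.
have pos x : 0 < f x -> a <= x /\ x <= d.
  move=> fx; have : level_cut f 0 x by rewrite level_cut0; exact: subset_closure.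
  by rewrite E1 /= in_itv /=; lra.
have eq1 x : 1 <= f x <-> b <= x /\ x <= c.
  have : level_cut f 1 x = (1 <= f x) :> Prop by rewrite level_cut_gt0.
  by move=> <-; rewrite E2 /= in_itv /=; split=> [/andP|[-> ->]].
have fb : 1 <= f b by apply/eq1; lra.
have fcc : 1 <= f c by apply/eq1; lra.
have [ab _] : a <= b /\ b <= d by apply: pos; lra.
have [_ cd] : a <= c /\ c <= d by apply: pos; lra.
(* The cut at level [min (f x) (f z)] is an interval containing [x] and [z], hence [y]. Level 0 is
   treated apart, its cut being a closure. *)
have quasi x y z : x <= y -> y <= z -> Num.min (f x) (f z) <= f y.
  move=> xy yz; set r := Num.min _ _.
  have rx : r <= f x by rewrite ge_min lexx.
  have rz : r <= f z by rewrite ge_min lexx orbT.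
  have [r0|r0] := leP r 0; first exact: le_trans r0 (f0 _).
  have [|l1 [l2 E]] := fcut r; first by have := f1 x; lra.
  rewrite level_cut_gt0// in E.
  have : [set x | r <= f x] x by [].
  have : [set x | r <= f x] z by [].
  rewrite E /= !in_itv /= => ? ?.
  have : [set x | r <= f x] y by rewrite E /= in_itv /=; lra.
  by [].
split=> //.
- lra.
- by move=> x ? ?; have : 1 <= f x by [apply/eq1]; have := f1 x; lra.
- move=> x xb; rewrite ltNge; apply/negP => /eq1; lra.
- move=> x xc; rewrite ltNge; apply/negP => /eq1; lra.
- move=> x y xy yb; have := quasi x y b xy yb.
  by rewrite ge_min => /orP[//|]; have := f1 x; lra.
- move=> x y xc xy; have := quasi c x y xc xy.
  by rewrite ge_min => /orP[|//]; have := f1 y; lra.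
- move=> x xa; apply/eqP; rewrite eq_le f0 andbT leNgt; apply/negP => /pos; lra.
- move=> x xd; apply/eqP; rewrite eq_le f0 andbT leNgt; apply/negP => /pos; lra.
Qed.

(** Fermat's rule: the sign lemma applied to [f] and to its reflection bounds the slope from both
    sides. *)
Lemma expands_max {R : realType} (f : R -> R) (c d : R) :
  (forall h, f h <= c) -> expands setT f c d -> d = 0.
Proof.
move=> fc fd; apply/eqP; rewrite eq_le; apply/andP; split.
  rewrite -oppr_ge0; apply: (@expands_ge0 _ (f \o -%R) c); last by near=> h => _; exact: fc.
  exact: expands_sub (expandsN fd).
by apply: (@expands_ge0 _ f c); [exact: expands_sub fd|near=> h => _; exact: fc].
Unshelve. all: by end_near. Qed.

Lemma derivable_oppr {R : realType} (f : R -> R) (x : R) :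
  derivable f (- x) 1 -> derivable (f \o -%R) x 1.
Proof.
move=> /derivable_expands[d fd]; apply/derivable_expands; exists (- d).
rewrite [X in expands _ X](_ : _ = (fun h => f (- x + h)) \o -%R).
  exact: expands_sub (expandsN fd).
by apply/funext => h /=; rewrite opprD.
Qed.

Lemma derivable_opprK {R : realType} (f : R -> R) (x : R) :
  derivable (f \o -%R) (- x) 1 -> derivable f x 1.
Proof.
move=> fd; have -> : f = (f \o -%R) \o -%R.
  by apply/funext => y /=; rewrite opprK.
exact: (@derivable_oppr _ (f \o -%R)).
Qed.

(** * Bounds for the sup-min convolution and balanced splits *)

Section supmin_bounds.
Context {R : realType}.
Implicit Types u w : R -> R.

Lemma supminC u w : supmin u w = supmin w u.
Proof.
apply/funext => x; rewrite /supmin; congr (sup _).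
by apply/seteqP; split=> _ [y _ <-]; exists (x - y) => //;
  rewrite subKr minC.
Qed.

Lemma supminN u w : supmin (u \o -%R) (w \o -%R) = supmin u w \o -%R.
Proof.
apply/funext => x; rewrite /supmin /=; congr (sup _).
by apply/seteqP; split=> _ [y _ <-]; exists (- y) => //=; rewrite ?opprK;
  congr (Num.min _ (w _)); lra.
Qed.

Lemma supmin_le u w (x M : R) :
  (forall y, Num.min (u y) (w (x - y)) <= M) -> supmin u w x <= M.
Proof. by move=> uwM; apply: ge_sup => [|_ [y _ <-]//]; exists (Num.min (u 0) (w (x - 0))), 0. Qed.

Lemma supmin_ge u w (y t : R) : (forall x, u x <= 1) ->
  Num.min (u y) (w t) <= supmin u w (y + t).
Proof.
move=> u1; apply: ub_le_sup; last by exists y => //; rewrite addrC addKr.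
by exists 1 => _ [z _ <-]; rewrite ge_min u1.
Qed.

Lemma supmin_gt0 u w (x : R) : 0 < supmin u w x ->
  exists y t, [/\ x = y + t, 0 < u y & 0 < w t].
Proof.
move=> /sup_gt[|_ [y _ <-]]; first by exists (Num.min (u 0) (w (x - 0))), 0.
by rewrite lt_min => /andP[? ?]; exists y, (x - y); split=> //; lra.
Qed.

Context (u w : R -> R) (a1 b1 c1 d1 a2 b2 c2 d2 : R).
Hypotheses (uU : unimodal u a1 b1 c1 d1) (wU : unimodal w a2 b2 c2 d2).

Lemma supmin_ge0 (x : R) : 0 <= supmin u w x.
Proof.
rewrite -(subrK 0 x) addrC subr0; apply: le_trans (supmin_ge w 0 x (um_le1 uU)).
by rewrite le_min (um_ge0 uU) (um_ge0 wU).
Qed.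

Lemma supmin_le1 (x : R) : supmin u w x <= 1.
Proof. by apply: supmin_le => y; rewrite ge_min (um_le1 uU). Qed.

(* Any [y' + t' = y + t] has [y' <= y] or [t' <= t]. *)
Lemma supmin_le_max (y t : R) : y <= b1 -> t <= b2 ->
  supmin u w (y + t) <= Num.max (u y) (w t).
Proof.
move=> yb tb; apply: supmin_le => y'; rewrite le_max !ge_min.
have [y'y|yy'] := leP y' y; first by rewrite (um_nd uU).
by rewrite [X in _ || X](_ : _ = true) ?orbT// (um_nd wU) ?orbT//; lra.
Qed.

(** Equal values make the lower bound [min] and the upper bound [max] coincide. *)
Lemma supmin_balanced (y t : R) : y <= b1 -> t <= b2 -> u y = w t ->
  supmin u w (y + t) = u y.
Proof.
move=> yb tb uw; apply/eqP; rewrite eq_le.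
have := supmin_le_max yb tb; have := supmin_ge w y t (um_le1 uU).
by rewrite -uw minxx maxxx => -> ->.
Qed.

Lemma supmin_plateau (x : R) : b1 + b2 <= x -> x <= c1 + c2 ->
  exists y t, [/\ x = y + t, u y = 1 & w t = 1].
Proof.
move=> bx xc; have bc1 := um_bc uU; have bc2 := um_bc wU.
(* The second summand stays at the right end of its core unless this pushes the first one left of
   [b1]. *)
have [x1|x1] := leP b1 (x - c2).
  exists (x - c2), c2; split; first lra.
    by apply: (um_top uU); lra.
  by apply: (um_top wU); lra.
exists b1, (x - b1); split; first lra.
  by apply: (um_top uU); lra.
by apply: (um_top wU); lra.
Qed.

Lemma supmin_eq1 (x : R) : b1 + b2 <= x -> x <= c1 + c2 -> supmin u w x = 1.
Proof.
move=> bx xc; have [y [t [-> uy wt]]] := supmin_plateau bx xc.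
apply/eqP; rewrite eq_le supmin_le1.
by have := supmin_ge w y t (um_le1 uU); rewrite uy wt minxx.
Qed.

(** The intermediate value theorem is applied to [u y - w (x - y)]. At each end of the admissible
    range of [y] one summand sits at an end of its increasing branch, which fixes the sign. *)
Lemma supmin_balance (x : R) : u a1 = w a2 -> a1 + a2 <= x -> x <= b1 + b2 ->
  exists y t, [/\ x = y + t, a1 <= y <= b1, a2 <= t <= b2 & u y = w t].
Proof.
move=> uwa ax xb; have ab1 := um_ab uU; have ab2 := um_ab wU.
have [bc1 cd1 bc2 cd2] := And4 (um_bc uU) (um_cd uU) (um_bc wU) (um_cd wU).
have ub : u b1 = 1 by apply: (um_top uU).
have wb : w b2 = 1 by apply: (um_top wU).
(* [[lo, hi]] consists of the [y] in [[a1, b1]] with [x - y] in [[a2, b2]]. *)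
pose lo := Num.max a1 (x - b2); pose hi := Num.min b1 (x - a2).
have [lo1 lo2] : a1 <= lo /\ x - b2 <= lo by rewrite !le_max !lexx orbT.
have [hi1 hi2] : hi <= b1 /\ hi <= x - a2 by rewrite !ge_min !lexx orbT.
have lohi : lo <= hi by rewrite ge_max !le_min; lra.
have glo : u lo - w (x - lo) <= 0.
  rewrite /lo; have [h|h] := leP a1 (x - b2).
    by rewrite subKr wb subr_le0 (um_le1 uU).
  by rewrite subr_le0 uwa (um_nd wU)//; lra.
have ghi : 0 <= u hi - w (x - hi).
  rewrite /hi; have [h|h] := leP b1 (x - a2).
    by rewrite ub subr_ge0 (um_le1 wU).
  by rewrite subKr subr_ge0 -uwa (um_nd uU)//; lra.
have gc : {within `[lo, hi], continuous (fun y => u y - w (x - y))}.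
  apply/within_continuousP => y e /=; rewrite in_itv /= => /andP[loy yhi] e0.
  have e20 : 0 < e / 2 by lra.
  have yad : `[a1, d1]%classic y by rewrite /= in_itv /=; lra.
  have xyad : `[a2, d2]%classic (x - y) by rewrite /= in_itv /=; lra.
  have /within_continuousP/(_ y _ yad e20) /= uc := um_cont uU.
  have /within_continuousP/(_ (x - y) _ xyad e20)/near0N /= wc := um_cont wU.
  near=> h; rewrite in_itv /= => /andP[loyh yhhi].
  have : `[a1, d1]%classic (y + h) -> `|u (y + h) - u y| <= e / 2 by near: h.
  have : `[a2, d2]%classic (x - y + - h) ->
    `|w (x - y + - h) - w (x - y)| <= e / 2 by near: h.
  rewrite /= !in_itv /= opprD addrA => wh uh.
  have {}wh : `|w (x - y - h) - w (x - y)| <= e / 2 by apply: wh; lra.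
  have {}uh : `|u (y + h) - u y| <= e / 2 by apply: uh; lra.
  move: wh uh; rewrite !ler_norml; lra.
have [|y] := IVT (v := 0) lohi gc.
  by rewrite ge_min le_max glo ghi orbT.
rewrite in_itv /= => /andP[loy yhi] g0.
by exists y, (x - y); split; lra.
Unshelve. all: by end_near. Qed.

(** The strict inequalities keep both moved points left of the cores for small [h] of either sign,
    so the [min] and [max] bounds apply on both sides of 0. *)
Lemma supmin_expands (y t l d : R) : y < b1 -> t < b2 -> u y = w t ->
  expands setT (fun h => u (y + l * h)) (u y) d ->
  expands setT (fun h => w (t + (1 - l) * h)) (u y) d ->
  expands setT (fun h => supmin u w (y + t + h)) (supmin u w (y + t)) d.
Proof.
move=> yb tb uw ud wd; rewrite supmin_balanced ?ltW//.
apply: expands_squeeze ud wd; near=> h => _.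
have -> : y + t + h = (y + l * h) + (t + (1 - l) * h) by ring.
rewrite supmin_ge ?supmin_le_max//; last exact: um_le1 uU.
- by apply: ltW; near: h; exact: near0_lt_add.
- by apply: ltW; near: h; exact: near0_lt_add.
Unshelve. all: by end_near. Qed.

(* Where both slopes vanish any split of the increment works, including the
   junk value [l = 0 / 0 = 0]. *)
Lemma balance_slopes (p q : R) : 0 <= p -> 0 <= q ->
  exists l, l * p = (1 - l) * q.
Proof.
move=> p0 q0; exists (q / (p + q)).
have [pq|pq] := eqVneq (p + q) 0; last by field.
have -> : p = 0 by lra.
have -> : q = 0 by lra.
by rewrite !mulr0.
Qed.

End supmin_bounds.

(** * Slopes on the increasing branch *)

Lemma unimodal_slope_ge0 {R : realType} (f : R -> R) (a b c d x p : R) :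
  unimodal f a b c d -> x <= b -> expands setT (fun h => f (x + h)) (f x) p ->
  0 <= p.
Proof.
move=> fU xb fp; apply: (@expands_ge0 _ (fun h => f (x + h)) (f x)).
  exact: expands_sub fp.
by near=> h => h0; apply: (um_nd fU) => //; lra.
Unshelve. all: by end_near. Qed.

(** By monotonicity [f] is constant on [[a, x]], so the slope seen from the left is 0. This serves
    splits whose other summand sits at the end of its support. *)
Lemma unimodal_flat_slope {R : realType} (f : R -> R) (a b c d x p : R) :
  unimodal f a b c d -> a < x -> x <= b -> f x = f a ->
  expands setT (fun h => f (x + h)) (f x) p -> p = 0.
Proof.
move=> fU ax xb fxa fp; apply/eqP; rewrite eq_le.
rewrite (unimodal_slope_ge0 fU xb fp) andbT -oppr_ge0.
apply: (@expands_ge0 _ (fun h => - f (x + h)) (- f x)).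
  move=> e e0; apply: filterS (fp e e0) => h fh _; rewrite -normrN.
  by have := fh I; congr (`|_| <= _); lra.
near=> h => h0; rewrite lerN2 fxa; apply: (um_nd fU); last lra.
have : a < x + 1 * h by near: h; exact: near0_gt_add.
lra.
Unshelve. all: by end_near. Qed.

(** * The hypotheses in endpoint form and their reflection *)

(** Here [[a, d]] is the support and [[b, c]] the core of each function. Left and right conditions
    come in mirrored pairs, so that [x |-> - x] preserves the record. *)
Record smoothable {R : realType} (u w : R -> R) (a1 b1 c1 d1 a2 b2 c2 d2 : R)
  : Prop := Smoothable {
  sm_u : unimodal u a1 b1 c1 d1;
  sm_w : unimodal w a2 b2 c2 d2;
  sm_eql : u a1 = w a2;
  sm_eqr : u d1 = w d2;
  sm_dul : forall x, a1 < x -> x < b1 -> derivable u x 1;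
  sm_dur : forall x, c1 < x -> x < d1 -> derivable u x 1;
  sm_dw : forall x, a2 < x -> x < d2 -> derivable w x 1;
  sm_topl : a1 < b1 -> b1 < d1 -> ~ derivable u b1 1 ->
    expands [set h | h < 0] (fun h => w (b2 + h)) (w b2) 0;
  sm_topr : a1 < c1 -> c1 < d1 -> ~ derivable u c1 1 ->
    expands [set h | 0 < h] (fun h => w (c2 + h)) (w c2) 0 }.

Section smoothing.
Context {R : realType}.

Lemma expands_oppr (A B : set R) (f : R -> R) (x c d : R) :
  (forall h, A h -> B (- h)) -> expands B (fun h => f (- x + h)) c d ->
  expands A (fun h => f (- (x + h))) c (- d).
Proof.
move=> AB /expandsN fd.
rewrite [X in expands _ X](_ : _ = (fun h => f (- x + h)) \o -%R).
  exact: expands_sub fd.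
by apply/funext => h /=; rewrite opprD.
Qed.

(** Reflection exchanges the left and right fields, so every result on the left branch yields its
    right-hand counterpart. *)
Lemma smoothableN (u w : R -> R) (a1 b1 c1 d1 a2 b2 c2 d2 : R) :
  smoothable u w a1 b1 c1 d1 a2 b2 c2 d2 ->
  smoothable (u \o -%R) (w \o -%R)
    (- d1) (- c1) (- b1) (- a1) (- d2) (- c2) (- b2) (- a2).
Proof.
case=> uU wU el er dul dur dw tl tr.
have nd x : ~ derivable (u \o -%R) (- x) 1 -> ~ derivable u x 1.
  by move=> nd du; apply: nd; apply: derivable_oppr; rewrite opprK.
split; rewrite /= ?opprK//; try exact: unimodalN.
- by move=> x ? ?; apply: derivable_oppr; apply: dur; lra.
- by move=> x ? ?; apply: derivable_oppr; apply: dul; lra.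
- by move=> x ? ?; apply: derivable_oppr; apply: dw; lra.
- move=> ac cd /nd {}nd; rewrite -oppr0.
  apply: (@expands_oppr _ [set h | 0 < h]) => [h /=|]; first by rewrite oppr0 oppr_gt0.
  by rewrite opprK; apply: tr => //; lra.
- move=> ac cd /nd {}nd; rewrite -oppr0.
  apply: (@expands_oppr _ [set h | h < 0]) => [h /=|]; first by rewrite oppr0 oppr_lt0.
  by rewrite opprK; apply: tl => //; lra.
Qed.

(** * Differentiability on the left branch and at the left end of the plateau *)

Section left_side.
Context (u w : R -> R) (a1 b1 c1 d1 a2 b2 c2 d2 : R).
Hypothesis uwS : smoothable u w a1 b1 c1 d1 a2 b2 c2 d2.

Lemma supmin_derivable_left (x : R) :
  a1 + a2 < x -> x < b1 + b2 -> derivable (supmin u w) x 1.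
Proof.
move=> ax xb; have [uU wU el er dul dur dw _ _] := uwS.
have [bc1 cd1 bc2 cd2] := And4 (um_bc uU) (um_cd uU) (um_bc wU) (um_cd wU).
have [y [t [xE /andP[ay yb] /andP[a2t tb] uw]]] :=
  supmin_balance uU wU el (ltW ax) (ltW xb).
(* A common value 1 would force [y = b1] and [t = b2], against [x < b1 + b2]. *)
have uy1 : u y < 1.
  have [/(um_ltl uU)//|b1y] := ltP y b1.
  by rewrite uw; apply: (um_ltl wU); lra.
have {}yb : y < b1 by rewrite ltNge; apply/negP => yb'; have := um_top uU yb'; lra.
have {}tb : t < b2 by rewrite ltNge; apply/negP => tb'; have := um_top wU tb'; lra.
suff [l [d [ud wd]]] : exists l d,
    expands setT (fun h => u (y + l * h)) (u y) d /\
    expands setT (fun h => w (t + (1 - l) * h)) (u y) d.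
  apply/derivable_expands; exists d; rewrite xE.
  exact: (supmin_expands uU wU yb tb uw ud wd).
have cst (f : R -> R) z : expands setT (fun h => f (z + 0 * h)) (f z) 0.
  by apply: expands_cst; near=> h => _; rewrite mul0r addr0.
(* At [y = a1] nothing is known about the slope of [u], so [t] takes the whole increment ([l = 0]).
   Since [w t = w a2] with [a2 < t], its slope there is 0. *)
have [ya|ya] := eqVneq y a1.
  have at' : a2 < t by lra.
  have /derivable_expands[q wq] : derivable w t 1 by apply: dw; lra.
  have q0 := unimodal_flat_slope wU at' (ltW tb) _ wq.
  exists 0, 0; split=> //; rewrite subr0 uw.
  have -> : 0 = 1 * q :> R by rewrite q0 ?mulr0// -el -uw ya.
  exact: expands_scale.
have ay' : a1 < y by rewrite lt_neqAle eq_sym ya.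
have /derivable_expands[p up] : derivable u y 1 by exact: dul.
(* Symmetric case: [y] takes the whole increment ([l = 1]), again with slope 0. *)
have [ta|ta] := eqVneq t a2.
  have p0 := unimodal_flat_slope uU ay' (ltW yb) _ up.
  exists 1, 0; rewrite subrr uw; split=> //; rewrite -uw.
  have -> : 0 = 1 * p :> R by rewrite p0 ?mulr0// el uw ta.
  exact: expands_scale.
have at' : a2 < t by rewrite lt_neqAle eq_sym ta.
have /derivable_expands[q wq] : derivable w t 1 by apply: dw; lra.
have p0 := unimodal_slope_ge0 uU (ltW yb) up.
have q0 := unimodal_slope_ge0 wU (ltW tb) wq.
have [l lpq] := balance_slopes p0 q0.
exists l, (l * p); split; first exact: expands_scale.
by rewrite lpq uw; exact: expands_scale.
Unshelve. all: by end_near. Qed.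

(* The core point of one summand can be kept fixed while the other one absorbs
   the increment, so one flat factor suffices. *)
Lemma supmin_top_left : a1 + a2 < b1 + b2 -> b1 + b2 < d1 + d2 ->
  expands [set h | h < 0] (fun h => supmin u w (b1 + b2 + h)) 1 0.
Proof.
move=> ab bd; have [uU wU el er dul dur dw tl _] := uwS.
have [ab1 ab2] := conj (um_ab uU) (um_ab wU).
have [bc1 cd1 bc2 cd2] := And4 (um_bc uU) (um_cd uU) (um_bc wU) (um_cd wU).
have ub : u b1 = 1 by apply: (um_top uU).
have wb : w b2 = 1 by apply: (um_top wU).
(* If one support began at its core, the equal starting values would force the same for the other,
   against [a1 + a2 < b1 + b2]. *)
have ab1' : a1 < b1.
  rewrite ltNge; apply/negP => ba; have ua : u a1 = 1 by apply: (um_top uU); lra.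
  by have := @um_ltl _ _ _ _ _ _ wU a2; rewrite -el ua; lra.
have ab2' : a2 < b2.
  rewrite ltNge; apply/negP => ba; have wa : w a2 = 1 by apply: (um_top wU); lra.
  by have := @um_ltl _ _ _ _ _ _ uU a1; rewrite el wa; lra.
have one : expands [set h | h < 0] (fun=> 1 : R) 1 0.
  by apply: expands_cst; near=> h.
have via_u : expands [set h | h < 0] (fun h => u (b1 + h)) 1 0 ->
    expands [set h | h < 0] (fun h => supmin u w (b1 + b2 + h)) 1 0.
  move=> ue; apply: expands_squeeze ue one; near=> h => _.
  rewrite [X in _ && X](_ : _ = true) ?andbT; last first.
    by rewrite le_max (supmin_le1 _ uU) orbT.
  have := supmin_ge w (b1 + h) b2 (um_le1 uU); rewrite wb.
  by rewrite (_ : b1 + h + b2 = b1 + b2 + h) //; ring.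
have via_w : expands [set h | h < 0] (fun h => w (b2 + h)) 1 0 ->
    expands [set h | h < 0] (fun h => supmin u w (b1 + b2 + h)) 1 0.
  move=> we; apply: expands_squeeze we one; near=> h => _.
  rewrite [X in _ && X](_ : _ = true) ?andbT; last first.
    by rewrite le_max (supmin_le1 _ uU) orbT.
  have := supmin_ge w b1 (b2 + h) (um_le1 uU); rewrite ub minC.
  by rewrite addrA.
(* A point of value 1 is a global maximum, so a derivative there vanishes. *)
have flat f a b c d z : unimodal f a b c d -> f z = 1 -> derivable f z 1 ->
    expands [set h | h < 0] (fun h => f (z + h)) 1 0.
  move=> fU fz /derivable_expands[p]; rewrite fz => fp.
  rewrite -(expands_max _ fp); first exact: expands_sub fp.
  by move=> h; exact: um_le1 fU _.
(* If [b1] is an inner point, either [u] is differentiable there or the hypothesis on [w] applies.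
   Otherwise [b1 = d1], so [b2 < d2] and [w] is differentiable at the inner point [b2]. *)
have [bd1|db1] := ltP b1 d1.
  have [ud|nud] := pselect (derivable u b1 1); first by apply: via_u; exact: flat uU _ _.
  by apply: via_w; rewrite -wb; exact: tl.
apply: via_w; apply: flat wU _ _ => //; apply: dw; lra.
Unshelve. all: by end_near. Qed.

(** To the right of [b1 + b2] the convolution is constantly 1 just left of [x]; only the corner
    itself needs the preceding result. *)
Lemma supmin_plateau_left (x : R) : a1 + a2 < x -> x < d1 + d2 ->
  b1 + b2 <= x -> x <= c1 + c2 ->
  expands [set h | h < 0] (fun h => supmin u w (x + h)) 1 0.
Proof.
move=> ax xd bx xc; have [uU wU _ _ _ _ _ _ _] := uwS.
have [bE|bE] := eqVneq x (b1 + b2); first by rewrite bE in ax xd *; exact: supmin_top_left.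
have {}bx : b1 + b2 < x by rewrite lt_neqAle eq_sym bE.
apply: expands_cst; near=> h => /= h0.
apply: (supmin_eq1 uU wU); last lra.
apply: ltW; rewrite -(mul1r h); near: h; exact: near0_gt_add.
Unshelve. all: by end_near. Qed.

End left_side.

(** * Continuity at the left end of the support *)

(** Only the first summand moves while the second stays at [a2]; the bounds then reduce the claim to
    continuity of [u] at [a1]. *)
Lemma supmin_left_end_aux (u w : R -> R) (a1 b1 c1 d1 a2 b2 c2 d2 e : R) :
  unimodal u a1 b1 c1 d1 -> unimodal w a2 b2 c2 d2 -> u a1 = w a2 ->
  a1 < d1 -> 0 < e ->
  \forall h \near (0 : R), 0 <= h ->
    `|supmin u w (a1 + a2 + h) - supmin u w (a1 + a2)| <= e.
Proof.
move=> uU wU el ad e0.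
have [ab1 ab2] := conj (um_ab uU) (um_ab wU).
have [bc1 cd1 bc2 cd2] := And4 (um_bc uU) (um_cd uU) (um_bc wU) (um_cd wU).
rewrite (supmin_balanced uU wU ab1 ab2 el).
have aad : `[a1, d1]%classic a1 by rewrite /= in_itv /=; lra.
have /within_continuousP/(_ a1 _ aad e0) /= uc := um_cont uU.
(* The [max] bound requires [a1 + h <= b1]. If [u a1 = 1] this may fail, but then the bound by 1
   suffices. *)
have ub : \forall h \near (0 : R), u a1 < 1 -> a1 + h <= b1.
  have [u1|u1] := ltP (u a1) 1; last by near=> h; lra.
  have ab : a1 < b1.
    by rewrite ltNge; apply/negP => ba; have := um_top uU ba; lra.
  near=> h => _; apply: ltW; rewrite -(mul1r h); near: h; exact: near0_lt_add.
near=> h => h0.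
have uh : `|u (a1 + h) - u a1| <= e.
  have : (a1 + h \in `[a1, d1]) -> `|u (a1 + h) - u a1| <= e by near: h.
  apply; rewrite in_itv /=; apply/andP; split; first lra.
  by apply: ltW; rewrite -(mul1r h); near: h; exact: near0_lt_add.
have zE : a1 + a2 + h = (a1 + h) + a2 by ring.
have zl := supmin_ge w (a1 + h) a2 (um_le1 uU).
have zu : supmin u w (a1 + h + a2) <= Num.max (u (a1 + h)) (u a1).
  have [u1|u1] := ltP (u a1) 1; last first.
    by rewrite le_max (le_trans (supmin_le1 _ uU _) u1) orbT.
  rewrite [X in Num.max _ X]el; apply: (supmin_le_max uU wU) => //.
  by move: u1; near: h.
move: zl zu uh; rewrite zE -el le_max ge_min !ler_norml.
by move=> /orP[] ? /orP[] ? /andP[? ?]; lra.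
Unshelve. all: by end_near. Qed.

(** At least one support is nondegenerate; commutativity makes it the first. *)
Lemma supmin_left_end (u w : R -> R) (a1 b1 c1 d1 a2 b2 c2 d2 e : R) :
  unimodal u a1 b1 c1 d1 -> unimodal w a2 b2 c2 d2 -> u a1 = w a2 ->
  a1 + a2 < d1 + d2 -> 0 < e ->
  \forall h \near (0 : R), 0 <= h ->
    `|supmin u w (a1 + a2 + h) - supmin u w (a1 + a2)| <= e.
Proof.
move=> uU wU el ad e0; have [ad1|da1] := ltP a1 d1.
  exact: supmin_left_end_aux uU wU el ad1 e0.
rewrite supminC (addrC a1).
by apply: (supmin_left_end_aux wU uU) => //; lra.
Qed.

(** * Regularity on the whole support *)

Section smoothed.
Context (u w : R -> R) (a1 b1 c1 d1 a2 b2 c2 d2 : R).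
Hypothesis uwS : smoothable u w a1 b1 c1 d1 a2 b2 c2 d2.

(** Off the plateau the left-branch result applies, directly or after reflection; on it both
    one-sided slopes are 0 and glue. *)
Lemma supmin_derivable (x : R) :
  a1 + a2 < x -> x < d1 + d2 -> derivable (supmin u w) x 1.
Proof.
move=> ax xd; have [uU wU _ _ _ _ _ _ _] := uwS.
have [xb|bx] := ltP x (b1 + b2); first exact: supmin_derivable_left uwS _ ax xb.
have [cx|xc] := ltP (c1 + c2) x.
  apply: derivable_opprK; rewrite -supminN.
  by apply: (supmin_derivable_left (smoothableN uwS)); lra.
have x1 : supmin u w (x + 0) = 1 by rewrite addr0 (supmin_eq1 uU wU).
apply/derivable_expands; exists 0; rewrite -[X in supmin u w X]addr0.
apply: (@expandsT _ (fun h => supmin u w (x + h))); rewrite x1.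
  exact: (supmin_plateau_left uwS).
have -> : (fun h => supmin u w (x + h)) = fun h => supmin u w (- (- x - h)).
  by apply/funext => h; rewrite opprB opprK addrC.
have := supmin_plateau_left (smoothableN uwS) (x := - x).
move=> /(_ ltac:(lra) ltac:(lra) ltac:(lra) ltac:(lra)) /expandsN.
rewrite supminN oppr0 => ze.
by apply: expands_sub ze => h /=; rewrite oppr_lt0.
Qed.

(** Inner points are covered by differentiability, the two ends by the one-sided estimate and its
    reflection; a one-point support is trivial. *)
Lemma supmin_continuous :
  {within `[a1 + a2, d1 + d2], continuous (supmin u w)}.
Proof.
have [uU wU el er _ _ _ _ _] := uwS.
apply/within_continuousP => x e /=; rewrite in_itv /= => /andP[ax xd] e0.
have [ad|da] := ltP (a1 + a2) (d1 + d2); last first.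
  near=> h; rewrite in_itv /= => ?.
  by rewrite (_ : h = 0) ?addr0 ?subrr ?normr0 ?ltW//; lra.
have [xa|xa] := eqVneq x (a1 + a2).
  have := supmin_left_end uU wU el ad e0; rewrite xa.
  by apply: filterS => h zh; rewrite in_itv /= => ?; apply: zh; lra.
have [xd'|xd'] := eqVneq x (d1 + d2).
  have := supmin_left_end (unimodalN uU) (unimodalN wU) (e := e).
  rewrite /= !opprK => /(_ er ltac:(lra) e0) /near0N; rewrite supminN /= xd'.
  apply: filterS => h zh; rewrite in_itv /= => /andP[_ dh].
  have := zh ltac:(lra); congr (`|supmin _ _ _ - supmin _ _ _| <= _); lra.
have /derivable1_diffP/differentiable_continuous/cvgrPdist_le/(_ e e0) :
    derivable (supmin u w) x 1.
  by apply: supmin_derivable; rewrite lt_neqAle ?ax ?xd ?andbT// eq_sym.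
by move=> /nbhs0P; apply: filterS => h zh _; rewrite distrC.
Unshelve. all: by end_near. Qed.

(** * Level cuts of the convolution *)

(** A split attaining the supremum with equal values turns [r <= supmin u w x] into [r <= u y] and
    [r <= w t]. *)
Lemma supmin_attained (x : R) : a1 + a2 <= x -> x <= d1 + d2 ->
  exists y t, [/\ x = y + t, supmin u w x = u y & supmin u w x = w t].
Proof.
move=> ax xd; have [uU wU el er _ _ _ _ _] := uwS.
have [xb|bx] := leP x (b1 + b2).
  have [y [t [-> /andP[ay yb] /andP[a2t tb] uw]]] := supmin_balance uU wU el ax xb.
  by exists y, t; rewrite (supmin_balanced uU wU yb tb uw).
have [cx|xc] := leP (c1 + c2) x; last first.
  have [y [t [xE uy wt]]] := supmin_plateau uU wU (ltW bx) (ltW xc).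
  by exists y, t; rewrite uy wt (supmin_eq1 uU wU) ?ltW.
have uU' := unimodalN uU; have wU' := unimodalN wU.
have [|||y [t [xE /andP[ay yb] /andP[a2t tb] uw]]] :=
  supmin_balance uU' wU' (x := - x).
- by rewrite /= !opprK.
- lra.
- lra.
have := supmin_balanced uU' wU' yb tb uw.
rewrite -xE supminN /= opprK => zu.
by exists (- y), (- t); split; [lra| |rewrite zu].
Qed.

Lemma level_cut_supmin (r l1 r1 l2 r2 : R) : 0 < r -> r <= 1 ->
  level_cut u r = `[l1, r1]%classic -> level_cut w r = `[l2, r2]%classic ->
  level_cut (supmin u w) r = `[l1 + l2, r1 + r2]%classic.
Proof.
move=> r0 r_le1; rewrite !level_cut_gt0// => uE wE.
have [uU wU _ _ _ _ _ _ _] := uwS.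
have ucut y : r <= u y <-> l1 <= y /\ y <= r1.
  have : [set x | r <= u x] y = (r <= u y) :> Prop by [].
  by move=> <-; rewrite uE /= in_itv /=; split=> [/andP|[-> ->]].
have wcut y : r <= w y <-> l2 <= y /\ y <= r2.
  have : [set x | r <= w x] y = (r <= w y) :> Prop by [].
  by move=> <-; rewrite wE /= in_itv /=; split=> [/andP|[-> ->]].
apply/seteqP; split=> x /=; rewrite in_itv /=.
  (* Positivity of [r] gives a split with positive values, which places [x] in the sum of the
     supports, where the supremum is attained. *)
  move=> rz; have [y0 [t0 [xE uy0 wt0]]] := supmin_gt0 (lt_le_trans r0 rz).
  have [ay0 yd0] : a1 <= y0 /\ y0 <= d1.
    split; rewrite leNgt; apply/negP.
      by move=> /(um_outl uU); lra.
    by move=> /(um_outr uU); lra.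
  have [at0 td0] : a2 <= t0 /\ t0 <= d2.
    split; rewrite leNgt; apply/negP.
      by move=> /(um_outl wU); lra.
    by move=> /(um_outr wU); lra.
  have [||y [t [xyt zu zw]]] := @supmin_attained x; [lra|lra|].
  have [] : l1 <= y /\ y <= r1 by apply/ucut; rewrite -zu.
  have [] : l2 <= t /\ t <= r2 by apply/wcut; rewrite -zw.
  lra.
move=> /andP[lx xr].
(* Both cuts contain the cores, so the two intervals are nonempty and every point of their sum
   splits. *)
have [l1b br1] : l1 <= b1 /\ b1 <= r1.
  by apply/ucut; rewrite (um_top uU) ?lexx ?(um_bc uU).
have [l2b br2] : l2 <= b2 /\ b2 <= r2.
  by apply/wcut; rewrite (um_top wU) ?lexx ?(um_bc wU).
have [y [uy wy]] : exists y, r <= u y /\ r <= w (x - y).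
  have [h|h] := leP l1 (x - r2).
    by exists (x - r2); split; [apply/ucut|apply/wcut]; lra.
  by exists l1; split; [apply/ucut|apply/wcut]; lra.
have := supmin_ge w y (x - y) (um_le1 uU); rewrite subrKC.
by apply: le_trans; rewrite le_min uy wy.
Qed.

(** One inclusion holds because the sum interval is closed; for the other, both summands are
    approximated within [e / 2] by points of positive value. *)
Lemma level_cut0_supmin :
  level_cut u 0 = `[a1, d1]%classic -> level_cut w 0 = `[a2, d2]%classic ->
  level_cut (supmin u w) 0 = `[a1 + a2, d1 + d2]%classic.
Proof.
rewrite !level_cut0 => uE wE; have [uU wU _ _ _ _ _ _ _] := uwS.
apply/seteqP; split.
  have /closure_id -> : closed `[a1 + a2, d1 + d2]%classic by exact: itv_closed.
  apply: closure_subset => x /= /supmin_gt0[y [t [-> uy wt]]].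
  have : closure [set x | 0 < u x] y by exact: subset_closure.
  have : closure [set x | 0 < w x] t by exact: subset_closure.
  by rewrite uE wE /= !in_itv /=; lra.
move=> x /=; rewrite in_itv /= => /andP[ax xd].
have [ad1 ad2] : a1 <= d1 /\ a2 <= d2.
  by have := um_ab uU; have := um_bc uU; have := um_cd uU;
     have := um_ab wU; have := um_bc wU; have := um_cd wU; lra.
have [y [uy wy]] : exists y, `[a1, d1]%classic y /\ `[a2, d2]%classic (x - y).
  rewrite /=; have [h|h] := leP a1 (x - d2).
    by exists (x - d2); rewrite !in_itv /=; lra.
  by exists a1; rewrite !in_itv /=; lra.
rewrite -uE in uy; rewrite -wE in wy.
move=> B /nbhs_ballP[e /= e0 Be].
have e20 : 0 < e / 2 by lra.
have [y' [uy' yy']] := uy _ (nbhsx_ballx y _ e20).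
have [t' [wt' tt']] := wy _ (nbhsx_ballx (x - y) _ e20).
exists (y' + t'); split.
  apply: lt_le_trans (supmin_ge w y' t' (um_le1 uU)).
  by rewrite lt_min; apply/andP.
apply: Be; move: yy' tt'; rewrite /ball /= !ltr_norml; lra.
Qed.

End smoothed.

(** * Assembling the conclusion *)

Lemma supmin_fuzzyD (u w : R -> R) (b1 c1 b2 c2 : R) :
  fuzzyC u -> fuzzyC w ->
  smoothable u w (lend u 0) b1 c1 (rend u 0) (lend w 0) b2 c2 (rend w 0) ->
  fuzzyD (supmin u w).
Proof.
move=> uC wC uwS; have [uU wU _ _ _ _ _ _ _] := uwS.
have [uE _] := fuzzyC_unimodal uC; have [wE _] := fuzzyC_unimodal wC.
have zE := level_cut0_supmin uwS uE wE.
have ad : lend u 0 + lend w 0 <= rend u 0 + rend w 0.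
  by have := um_ab uU; have := um_bc uU; have := um_cd uU;
     have := um_ab wU; have := um_bc wU; have := um_cd wU; lra.
split; last first.
  move=> x; rewrite {1}/lend {1}/rend zE inf_itvcc// sup_itvcc// in_itv /=.
  by move=> /andP[? ?]; exact: (supmin_derivable uwS).
split; last by rewrite zE; exact: (supmin_continuous uwS).
split.
- by move=> x; rewrite (supmin_ge0 uU wU) (supmin_le1 _ uU).
- exists (b1 + b2); rewrite level_cut_gt0//= (supmin_eq1 uU wU)//.
  by rewrite lerD ?(um_bc uU) ?(um_bc wU).
(* Level 0 is separate because its cut is a closure. *)
- move=> r /andP[r0 r1]; have [->|rn0] := eqVneq r 0.
    by exists (lend u 0 + lend w 0), (rend u 0 + rend w 0).
  have r01 : 0 <= r <= 1 by rewrite r0.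
  have [[_ _ /(_ r r01)[l1 [r1' E1]]] _] := uC.
  have [[_ _ /(_ r r01)[l2 [r2' E2]]] _] := wC.
  exists (l1 + l2), (r1' + r2').
  by apply: (level_cut_supmin uwS) => //; rewrite lt_neqAle eq_sym rn0.
Qed.

End smoothing.

Unset Implicit Arguments.

Theorem theorem5p7 (R : realType) (u w : R -> R)
  (uN : fuzzyN u) (uC : fuzzyC u) (wD : fuzzyD w)
  (eql : w (lend w 0) = u (lend u 0))
  (eqr : w (rend w 0) = u (rend u 0))
  (topl : lend u 1 \in `]lend u 0, rend u 0[ ->
          ~ derivable u (lend u 1) 1 -> is_lderive w (lend w 1) 0)
  (topr : rend u 1 \in `]lend u 0, rend u 0[ ->
          ~ derivable u (rend u 1) 1 -> is_rderive w (rend w 1) 0) :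
  smoother u w.
Proof.
split=> //; first by case: uN.
have [wC wd] := wD; have [_ ud] := uN.
have [_ uU] := fuzzyC_unimodal uC; have [_ wU] := fuzzyC_unimodal wC.
apply: (supmin_fuzzyD uC wC (b1 := lend u 1) (c1 := rend u 1)
  (b2 := lend w 1) (c2 := rend w 1)).
split=> //.
- by move=> x ax xb; apply: ud; left; rewrite in_itv /= ax xb.
- by move=> x ax xb; apply: ud; right; rewrite in_itv /= ax xb.
- by move=> x ax xb; apply: wd; rewrite in_itv /= ax xb.
- move=> ab bd nd; apply: is_lderive_expands.
  by apply: topl => //; rewrite in_itv /= ab bd.
- move=> ab bd nd; apply: is_rderive_expands.
  by apply: topr => //; rewrite in_itv /= ab bd.
Qed.
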